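(* Let $\mathbf{V}$ be a matricially normed space and let $u\in\mathbf{V}$ with $\|u\|=1$. Then $u$ is a complete strict geometric unitary of $\mathbf{V}$, i.e. $n_{\mathrm{cb}}(\mathbf{V};u)=1$, if and only if there exist a Hilbert space $H$ and a complete isometry $\Theta:\mathbf{V}\to\mathcal{L}(H)$ such that $\Theta(u)=\mathrm{id}_H$.
   Context: All vector spaces are complex. $M_{m,n}$ is the space of complex $m\times n$ matrices with the operator norm and $M_n=M_{n,n}$. A matricially normed space $\mathbf{V}$ is a vector space with a norm on each $M_k(\mathbf{V})$ ($k\in\mathbb{N}$) such that $\|\alpha x\beta\|\le\|\alpha\|\|x\|\|\beta\|$ for all $x\in M_m(\mathbf{V})$, $\alpha\in M_{n,m}$, $\beta\in M_{m,n}$. For Hilbert space $H$, $\mathcal{L}(H)$ is the space of bounded operators, with $M_k(\mathcal{L}(H))=\mathcal{L}(H^k)$. For linear $\varphi:\mathbf{V}\to\mathbf{W}$, $\varphi_k:M_k(\mathbf{V})\to M_k(\mathbf{W})$ denotes entrywise application, $\|\varphi\|_{\mathrm{cb}}=\sup_k\|\varphi_k\|$, and $\mathrm{CB}(\mathbf{V},\mathbf{W})$ is the set of $\varphi$ with $\|\varphi\|_{\mathrm{cb}}<\infty$; $\varphi$ is a complete isometry if every $\varphi_k$ is isometric (not necessarily surjective). For $u\in\mathbf{V}$ with $\|u\|=1$ put $\mathcal{S}_n(\mathbf{V};u)=\{\varphi\in\mathrm{CB}(\mathbf{V},M_n):\|\varphi\|_{\mathrm{cb}}\le1,\ \varphi(u)=I_n\}$,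 $\gamma^u_k(x)=\sup\{\|\varphi_k(x)\|:\varphi\in\mathcal{S}_n(\mathbf{V};u),\ n\in\mathbb{N}\}$ for $x\in M_k(\mathbf{V})$, and $n_{\mathrm{cb}}(\mathbf{V};u)=\inf\{\gamma^u_k(x):x\in M_k(\mathbf{V}),\ \|x\|=1,\ k\in\mathbb{N}\}$. *)

(* Defs.v *)
From HB Require Import structures.
From mathcomp Require Import all_boot all_order all_algebra.
From mathcomp Require Import all_classical all_reals all_analysis.
From mathcomp Require Import complex.
From mathcomp Require Import sesquilinear.

Set Implicit Arguments.
Unset Strict Implicit.
Unset Printing Implicit Defensive.

Import Order.TTheory GRing.Theory Num.Theory.
Import numFieldNormedType.Exports.

Local Open Scope classical_set_scope.
Local Open Scope ring_scope.
Local Open Scope complex_scope.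

(* Matrix levels range over k >= 1, whence the indices k.+1 throughout. *)

Section ScalarMatrices.
Context {R : realType}.

(* Norms in a normed module over R[i] are R[i]-valued; we take real parts. *)
Definition rnorm (E : normedZmodType R[i]) (x : E) : R := complex.Re `|x|.

Lemma rnormE (E : normedZmodType R[i]) (x : E) : `|x| = (rnorm x)%:C.
Proof.
have := normr_ge0 x; rewrite /rnorm; case: `|x| => r s.
by rewrite lecE /= => /andP[/eqP -> _].
Qed.

Definition l2norm (E : normedZmodType R[i]) k (xi : 'I_k -> E) : R :=
  Num.sqrt (\sum_i rnorm (xi i) ^+ 2).

(* The norm that the library puts on 'cV[R[i]]_n is the sup norm, hence l2norm. *)
Definition opnorm m n (A : 'M[R[i]]_(m, n)) : R :=
  sup [set l2norm (fun i => (A *m v) i 0)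
      | v in [set v : 'cV[R[i]]_n | l2norm (fun j => v j 0) <= 1]].

Definition lmulmx (V : lmodType R[i]) m n p
    (a : 'M[R[i]]_(m, n)) (x : 'M[V]_(n, p)) : 'M[V]_(m, p) :=
  \matrix_(i, j) \sum_l a i l *: x l j.

Definition rmulmx (V : lmodType R[i]) m n p
    (x : 'M[V]_(m, n)) (b : 'M[R[i]]_(n, p)) : 'M[V]_(m, p) :=
  \matrix_(i, j) \sum_l b l j *: x i l.

End ScalarMatrices.

Section MatrixNorms.
Context {R : realType}.

Definition matrix_norms (V : Type) := forall k, 'M[V]_k.+1 -> R.

Record matricially_normed (V : lmodType R[i]) (N : matrix_norms V) : Prop := {
  mnorm_ge0 : forall k (x : 'M[V]_k.+1), 0 <= N k x;
  mnorm0_eq0 : forall k (x : 'M[V]_k.+1), N k x = 0 -> x = 0;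
  mnormD : forall k (x y : 'M[V]_k.+1), N k (x + y) <= N k x + N k y;
  mnormZ : forall k (c : R[i]) (x : 'M[V]_k.+1),
    N k (map_mx ( *:%R c) x) = rnorm c * N k x;
  mnorm_mulmx : forall m n (a : 'M[R[i]]_(n.+1, m.+1)) (x : 'M[V]_m.+1)
      (b : 'M[R[i]]_(m.+1, n.+1)),
    N n (rmulmx (lmulmx a x) b) <= opnorm a * N m x * opnorm b }.

Section Maps.
Context {V W : lmodType R[i]} (NV : matrix_norms V) (NW : matrix_norms W).

Definition amp_norm k (f : V -> W) : \bar R :=
  ereal_sup [set (@NW k (map_mx f x))%:E | x in [set x : 'M[V]_k.+1 | @NV k x <= 1]].

Definition cb_norm (f : V -> W) : \bar R :=
  ereal_sup [set amp_norm k f | k in [set: nat]].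

Definition completely_bounded (f : V -> W) : Prop := (cb_norm f < +oo)%E.

Definition complete_isometry (f : V -> W) : Prop :=
  forall k (x : 'M[V]_k.+1), @NW k (map_mx f x) = @NV k x.

End Maps.

(* M_k(M_n) is normed as M_(k n), by forgetting the block structure. *)
Definition mx_norms n : matrix_norms 'M[R[i]]_n.+1 :=
  fun k X => opnorm (\mxblock_(i < k.+1, j < k.+1) X i j).

Section NumericalIndex.
Context {V : lmodType R[i]} (N : matrix_norms V) (u : V).

Definition mx_states n : set {linear V -> 'M[R[i]]_n.+1} :=
  [set f : {linear V -> 'M[R[i]]_n.+1} | [/\ completely_bounded N (@mx_norms n) f,
               (cb_norm N (@mx_norms n) f <= 1)%E &
               f u = 1%:M]].

Definition state_seminorm k (x : 'M[V]_k.+1) : \bar R :=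
  ereal_sup [set y | exists n (f : {linear V -> 'M[R[i]]_n.+1}),
    mx_states f /\ y = (mx_norms (map_mx f x))%:E].

Definition n_cb : \bar R :=
  ereal_inf [set y | exists k (x : 'M[V]_k.+1),
    @N k x = 1 /\ y = state_seminorm x].

Definition complete_strict_geometric_unitary : Prop := n_cb = 1%E.

End NumericalIndex.

End MatrixNorms.

Record hilbertSpace (R : realType) := HilbertSpace {
  hilbert_sort :> completeNormedModType R[i];
  hilbert_dot : {dot hilbert_sort for Num.conj};
  hilbert_normE : forall x : hilbert_sort, `|x| ^+ 2 = hilbert_dot x x }.

Section BoundedOperators.
Context {R : realType} (H : hilbertSpace R).

Definition bounded_operator : {pred H -> H} := mem [set T : H -> H |
  linear T /\ exists M : R, forall x, rnorm (T x) <= M * rnorm x].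

Lemma bounded_operator_submod : submod_closed bounded_operator.
Proof.
split=> [|a S T /set_mem[Sl [MS hS]] /set_mem[Tl [MT hT]]]; apply/mem_set.
  split=> [b x y|]; first by rewrite /= scaler0 addr0.
  by exists 0 => x; rewrite mul0r /rnorm normr0.
split=> [b x y|].
  change (a *: S (b *: x + y) + T (b *: x + y) =
          b *: (a *: S x + T x) + (a *: S y + T y)).
  by rewrite Sl Tl !scalerDr !scalerA (mulrC a b) addrACA.
exists (rnorm a * MS + MT) => x.
change (rnorm (a *: S x + T x) <= (rnorm a * MS + MT) * rnorm x).
rewrite -lecR -rnormE (le_trans (ler_normD _ _))// normrZ !rnormE -rmorphM.
rewrite -rmorphD lecR mulrDl lerD// -mulrA ler_wpM2l ?hS//.
by rewrite -lecR -rnormE normr_ge0.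
Qed.

HB.instance Definition _ :=
  GRing.isSubmodClosed.Build _ _ bounded_operator bounded_operator_submod.

Record boundedOp := BoundedOp {
  boundedOp_fun :> H -> H;
  boundedOpP : boundedOp_fun \in bounded_operator }.

HB.instance Definition _ := [isSub of boundedOp for boundedOp_fun].
HB.instance Definition _ := [Choice of boundedOp by <:].
HB.instance Definition _ := [SubChoice_isSubLmodule of boundedOp by <:].

Lemma bounded_operator_id : id \in bounded_operator.
Proof. by apply/mem_set; split=> //; exists 1 => x; rewrite mul1r. Qed.

Definition idOp : boundedOp := BoundedOp bounded_operator_id.

(* M_k(L(H)) is normed as L(H^k). *)
Definition op_norms : matrix_norms boundedOp := fun k X =>
  sup [set l2norm (fun i => \sum_j X i j (xi j))
      | xi in [set xi : 'I_k.+1 -> H | l2norm xi <= 1]].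

End BoundedOperators.

(* Main.v *)
(** If [n_cb = 1], the matrix states [phi : V -> M_n] norm [V]: the direct sum of
all of them acts on the Hilbert sum of the spaces [C^n], realized as [l2 J] for [J]
the set of pairs of a state [s] and an index [a < n_s], is a complete isometry and
sends [u] to the identity.

Conversely, let [Theta] be a unital complete isometry into [L(H)], let [N x = 1] and
let [xi] be a unit vector of [H^k] almost norming [Theta_k(x)]. The compression of
[Theta] to the span [K] of the entries of [xi] and of [Theta_k(x) xi] is a state with
values in [L(K) = M_n], and it almost norms [x], because [xi] and [Theta_k(x) xi] both
have their entries in [K]. *)

From HB Require Import structures.
Require Import Defs.
From mathcomp Require Import all_boot all_order all_algebra finmap.
From mathcomp Require Import all_classical all_reals all_analysis.
From mathcomp Require Import complex sesquilinear summability ring lra.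

Set Implicit Arguments.
Unset Strict Implicit.
Unset Printing Implicit Defensive.

Import Order.TTheory GRing.Theory Num.Theory.
Import numFieldNormedType.Exports.

Local Open Scope classical_set_scope.
Local Open Scope ring_scope.
Local Open Scope complex_scope.

(** * Complex numbers and the Hilbert space l2 *)

Section RealNorm.
Context {R : realType}.

Section NormedZmod.
Context {E : normedZmodType R[i]}.
Implicit Types x y : E.

Lemma rnorm_ge0 x : 0 <= rnorm x.
Proof. by rewrite -lecR -rnormE normr_ge0. Qed.

Lemma rnorm0 : rnorm (0 : E) = 0.
Proof. by rewrite /rnorm normr0. Qed.

Lemma rnormD x y : rnorm (x + y) <= rnorm x + rnorm y.
Proof. by rewrite -lecR rmorphD /= -!rnormE ler_normD. Qed.

Lemma rnorm_eq0 x : (rnorm x == 0) = (x == 0).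
Proof. by rewrite -(inj_eq (@complexI R)) -rnormE normr_eq0. Qed.

Lemma rnorm_sum I (r : seq I) (P : pred I) (f : I -> E) :
  rnorm (\sum_(i <- r | P i) f i) <= \sum_(i <- r | P i) rnorm (f i).
Proof.
elim/big_ind2 : _ => [|x a y b xa yb|//]; first by rewrite rnorm0.
exact: le_trans (rnormD _ _) (lerD _ _).
Qed.

End NormedZmod.

Lemma rnormZ (E : normedModType R[i]) (c : R[i]) (x : E) :
  rnorm (c *: x) = rnorm c * rnorm x.
Proof. by apply: complexI; rewrite rmorphM /= -!rnormE normrZ. Qed.

Implicit Types z w : R[i].

Lemma rnormM z w : rnorm (z * w) = rnorm z * rnorm w.
Proof. by apply: complexI; rewrite rmorphM /= -!rnormE normrM. Qed.

Lemma sqr_rnorm z : rnorm z ^+ 2 = complex.Re z ^+ 2 + complex.Im z ^+ 2.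
Proof. by apply: complexI; rewrite rmorphXn /= -rnormE add_Re2_Im2. Qed.

Lemma sqr_rnorm_conj z : (rnorm z ^+ 2)%:C = z * z^*.
Proof. by rewrite rmorphXn /= -rnormE sqr_normc. Qed.

Lemma rnorm_real (r : R) : 0 <= r -> rnorm (r%:C) = r.
Proof. by move=> r0; rewrite /rnorm ger0_norm ?ler0c. Qed.

Lemma Re_le_rnorm z : complex.Re z <= rnorm z.
Proof.
rewrite (le_trans (ler_norm _))// -lecR -rnormE; exact: normc_ge_Re.
Qed.

(** The factor 2 comes from the parallelogram law. It is harmless, since the bound only serves to
    show that square-summable families are closed under addition. *)
Lemma sqr_rnormD_le z w :
  rnorm (z + w) ^+ 2 <= 2 * (rnorm z ^+ 2 + rnorm w ^+ 2).
Proof.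
rewrite !sqr_rnorm !raddfD /=.
have h (a b : R) : (a + b) ^+ 2 <= 2 * (a ^+ 2 + b ^+ 2).
  by have := sqr_ge0 (a - b); rewrite !expr2; nra.
have := h (complex.Re z) (complex.Re w); have := h (complex.Im z) (complex.Im w).
by lra.
Qed.

(** Polarization with two terms: [z + w] yields the real part and [z + 'i * w] the imaginary part.
    It turns sums of products into sums of squares, whose finite partial sums are monotone. *)
Lemma mul_conj_polar z w : z * w^* =
  ((rnorm (z + w) ^+ 2 - rnorm z ^+ 2 - rnorm w ^+ 2) / 2)%:C +
  'i * ((rnorm (z + 'i * w) ^+ 2 - rnorm z ^+ 2 - rnorm w ^+ 2) / 2)%:C.
Proof.
rewrite !sqr_rnorm; case: z w => [a b] [c d]; simpc.
by apply/eqP; rewrite eq_complex /=; apply/andP; split; apply/eqP; field.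
Qed.

Lemma Re_norm_le z : `|complex.Re z| <= rnorm z.
Proof. by rewrite -lecR -rnormE; exact: normc_ge_Re. Qed.

Lemma Im_norm_le z : `|complex.Im z| <= rnorm z.
Proof.
(* Up to sign, the imaginary part of [z] is the real part of its product with ['i], which has the
   same modulus. *)
rewrite -[X in `|X|]opprK normrN -ReiNIm (le_trans (Re_norm_le _))// rnormM.
rewrite -[leRHS]mulr1 ler_wpM2l ?rnorm_ge0//.
by rewrite /rnorm normc_def /= expr0n add0r expr1n sqrtr1.
Qed.

Lemma rnorm_le_ReIm z : rnorm z <= `|complex.Re z| + `|complex.Im z|.
Proof.
rewrite -ler_sqr ?nnegrE ?addr_ge0 ?rnorm_ge0// sqr_rnorm sqrrD !real_normK ?num_real//.
by rewrite addrAC lerDl mulrn_wge0// mulr_ge0.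
Qed.

Lemma cvg_complexP (T : Type) (F : set_system T) (FF : Filter F)
    (f : T -> R[i]^o) (l : R[i]^o) :
  (f t @[t --> F] --> l) <->
  ((complex.Re (f t) @[t --> F] --> complex.Re l) /\
   (complex.Im (f t) @[t --> F] --> complex.Im l)).
Proof.
split=> [/cvgrPdist_lt fl|[/cvgrPdist_lt fr /cvgrPdist_lt fi]].
  have {}fl (e : R) : 0 < e -> \forall t \near F, rnorm (l - f t) < e.
    move=> e0; have := fl e%:C; rewrite ltcR => /(_ e0).
    by apply: filterS => t; rewrite rnormE ltcR.
  split; apply/cvgrPdist_lt => e /fl; apply: filterS => t; apply: le_lt_trans.
    by rewrite -raddfB Re_norm_le.
  by rewrite -raddfB Im_norm_le.
(* The radius is a complex number; being positive, it has imaginary part zero. *)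
apply/cvgrPdist_lt => -[e e']; rewrite ltcE /= => /andP[/eqP -> e0].
have e20 : 0 < e / 2 by rewrite divr_gt0.
apply: filterS2 (fr _ e20) (fi _ e20) => t a b.
rewrite rnormE ltcR (le_lt_trans (rnorm_le_ReIm _))// [ltRHS]splitr !raddfB.
exact: ltrD.
Qed.

End RealNorm.

Section ComplexComplete.
Context {R : realType}.

(** Real and imaginary parts are 1-Lipschitz, so they carry [F] to Cauchy filters on the reals, and
    completeness is inherited from there. *)
Lemma complex_cauchy_cvg (F : set_system R[i]^o) : ProperFilter F ->
  (forall e : R, 0 < e -> exists z : R[i], \forall w \near F, rnorm (z - w) < e) ->
  exists l : R[i], F --> (l : R[i]^o).
Proof.
move=> FF Fc.
have cr (g : R[i] -> R) : (forall z w, `|g z - g w| <= rnorm (z - w)) ->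
    cvg (g z @[z --> F]).
  move=> gle; apply/cauchy_cvgP/cauchy_exP => e /= e0.
  have [z zF] := Fc _ e0; exists (g z); apply: filterS zF => w zw.
  by rewrite -ball_normE /=; exact: le_lt_trans (gle z w) zw.
have /cvg_ex[/= a ra] : cvg (complex.Re z @[z --> F]).
  by apply: cr => z w; rewrite -raddfB; exact: Re_norm_le.
have /cvg_ex[/= b ib] : cvg (complex.Im z @[z --> F]).
  by apply: cr => z w; rewrite -raddfB; exact: Im_norm_le.
by exists (a +i* b); apply/(cvg_complexP FF id).
Qed.
End ComplexComplete.

(* Limits along the directed set of finite subsets *)
#[local] Existing Instance totally_filter.

Section Totally.
Context {R : realType} {J : choiceType}.

(** A finite set at which [f] almost attains its supremum exists, and by monotonicity every larger
    finite set does as well. *)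
Lemma totally_monotone_cvg (f : {fset J} -> R) (M : R) :
    (forall A B : {fset J}, (A `<=` B)%fset -> f A <= f B) ->
    (forall A, f A <= M) ->
  f A @[A --> totally] --> sup (range f).
Proof.
move=> fm fM.
have hs : has_sup (range f).
  by split; [exists (f fset0), fset0|exists M => _ [A _ <-]].
apply/cvgrPdist_lt => e e0.
have [_ [A _ <-] lA] := sup_adherent e0 hs.
exists A => // B /= AB.
have fB : f B <= sup (range f) by apply: ub_le_sup; [exact: hs.2|exists B].
by rewrite ger0_norm ?subr_ge0// ltrBlDl -ltrBlDr (lt_le_trans lA) ?fm.
Qed.

End Totally.

(** The square of [dot v v *: u - dot u v *: v] is nonnegative and contains the positive factor
    [dot v v]; this form of the usual argument avoids division. *)
Lemma dot_CauchySchwarz (C : numClosedFieldType) (U : lmodType C)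
    (dot : {dot U for Num.conj}) (u v : U) :
  `|dot u v| ^+ 2 <= dot u u * dot v v.
Proof.
have [->|v0] := eqVneq v 0; first by rewrite linear0r normr0 expr0n mulr_ge0 ?dnorm_ge0.
have vv : 0 < dot v v by rewrite dnorm_gt0.
have := dnorm_ge0 dot (dot v v *: u - dot u v *: v).
have dotZZ a b : dot (a *: u) (b *: v) = a * (dot u v * Num.conj b).
  by rewrite linearZl_LR /= linearZr_LR /= (mulrC (Num.conj b)).
rewrite dnormB !dnormZ dotZZ -normCK.
rewrite rmorphM /= (CrealP _) ?ger0_real ?(ltW vv)//.
rewrite (CrealP _) ?rpredX ?normr_real// (gtr0_norm vv).
rewrite (_ : _ - _ = dot v v * (dot u u * dot v v - `|dot u v| ^+ 2)); last by ring.
by rewrite pmulr_rge0// subr_ge0.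
Qed.

(** * The Hilbert space of square-summable families *)

Section L2Space.
Context {R : realType} {J : choiceType}.
Implicit Types (A B : {fset J}).

Definition partial_nsq (x : J -> R[i]) A : R := \sum_(j <- A) rnorm (x j) ^+ 2.

Lemma partial_nsq_ge0 x A : 0 <= partial_nsq x A.
Proof. by apply: sumr_ge0 => j _; exact: sqr_ge0. Qed.

Lemma partial_nsq_le x A B : (A `<=` B)%fset -> partial_nsq x A <= partial_nsq x B.
Proof.
move=> AB; rewrite /partial_nsq [leRHS](big_fsetID _ (mem A)) /=.
have -> : [fset j in B | j \in A]%fset = A.
  apply/fsetP => j; rewrite !inE andbC.
  by case: (boolP (j \in A)) => // /(fsubsetP AB) ->.
by rewrite lerDl sumr_ge0// => j _; exact: sqr_ge0.
Qed.

Lemma partial_nsqZ (c : R[i]) x A :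
  partial_nsq (c *: x) A = rnorm c ^+ 2 * partial_nsq x A.
Proof.
rewrite /partial_nsq mulr_sumr; apply: eq_bigr => j _.
by rewrite -exprMn -rnormM.
Qed.

Lemma partial_nsqD_le x y A :
  partial_nsq (x + y) A <= 2 * (partial_nsq x A + partial_nsq y A).
Proof.
rewrite /partial_nsq -big_split /= mulr_sumr; apply: ler_sum => j _.
exact: sqr_rnormD_le.
Qed.

Definition square_summable : {pred J -> R[i]} :=
  mem [set x : J -> R[i] | exists M : R, forall A, partial_nsq x A <= M].

Lemma square_summable_submod : submod_closed square_summable.
Proof.
split=> [|c x y /set_mem[M hM] /set_mem[K hK]]; apply/mem_set.
  exists 0 => A; rewrite /partial_nsq big1// => j _.
  by rewrite rnorm0 expr0n.
exists (2 * (rnorm c ^+ 2 * M + K)) => A.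
rewrite (le_trans (partial_nsqD_le _ _ _))// ler_pM2l// lerD// partial_nsqZ.
by rewrite ler_wpM2l// sqr_ge0.
Qed.

HB.instance Definition _ :=
  GRing.isSubmodClosed.Build _ _ square_summable square_summable_submod.

Record l2 := L2 { l2_fun :> J -> R[i]; l2P : l2_fun \in square_summable }.

HB.instance Definition _ := [isSub of l2 for l2_fun].
HB.instance Definition _ := [Choice of l2 by <:].
HB.instance Definition _ := [SubChoice_isSubLmodule of l2 by <:].

Implicit Types x y z : l2.

Lemma l2B x y j : (x - y) j = x j - y j. Proof. by []. Qed.

Lemma l2_inj x y : x =1 y -> x = y.
Proof. by move=> xy; apply: val_inj; apply/funext. Qed.

Definition nsq x : R := sup (range (partial_nsq x)).

Lemma nsq_cvg x : partial_nsq x A @[A --> totally] --> nsq x.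
Proof.
have /set_mem[M hM] := l2P x.
by apply: (@totally_monotone_cvg _ _ _ M) => // A B; exact: partial_nsq_le.
Qed.

Lemma partial_nsq_nsq x A : partial_nsq x A <= nsq x.
Proof.
have /set_mem[M hM] := l2P x.
by apply: ub_le_sup; [exists M => _ [B _ <-]|exists A].
Qed.

Lemma nsq_le x M : (forall A, partial_nsq x A <= M) -> nsq x <= M.
Proof.
move=> h; apply: ge_sup => [|_ [A _ <-]//].
by exists (partial_nsq x fset0), fset0.
Qed.

Lemma nsq_ge0 x : 0 <= nsq x.
Proof. exact: le_trans (partial_nsq_ge0 x fset0) (partial_nsq_nsq _ _). Qed.

Lemma nsq_ge x j : rnorm (x j) ^+ 2 <= nsq x.
Proof.
rewrite (le_trans _ (partial_nsq_nsq x [fset j]%fset))//.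
by rewrite /partial_nsq big_seq_fset1.
Qed.

Lemma nsq_eq0 x : nsq x = 0 -> x = 0.
Proof.
move=> x0; apply: l2_inj => j; apply/eqP; rewrite -rnorm_eq0 -sqrf_eq0 eq_le sqr_ge0.
by rewrite -x0 nsq_ge.
Qed.

Definition partial_dot (x y : J -> R[i]) A : R[i]^o := \sum_(j <- A) x j * (y j)^*.

Lemma partial_dot_polar (x y : J -> R[i]) A : partial_dot x y A =
  ((partial_nsq (x + y) A - partial_nsq x A - partial_nsq y A) / 2)%:C +
  'i * ((partial_nsq (x + 'i *: y) A - partial_nsq x A - partial_nsq y A) / 2)%:C.
Proof.
rewrite /partial_dot /partial_nsq -!sumrB !mulr_suml !rmorph_sum mulr_sumr -big_split /=.
by apply: eq_bigr => j _; exact: mul_conj_polar.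
Qed.

(* The limit of the partial sums, read off from the polarization identity. *)
Definition l2_dot x y : R[i] :=
  (nsq (x + y) - nsq x - nsq y) / 2 +i* ((nsq (x + 'i *: y) - nsq x - nsq y) / 2).

Lemma l2_dot_cvg x y : partial_dot x y A @[A --> totally] --> (l2_dot x y : R[i]^o).
Proof.
apply/cvg_complexP; split=> /=.
  under eq_cvg do rewrite partial_dot_polar /= !(mul0r,subr0,mul1r,addr0).
  by apply: cvgMl; apply: cvgB; [apply: cvgB|]; exact: nsq_cvg.
under eq_cvg do rewrite partial_dot_polar /= !(mul0r,subr0,mul1r,addr0,add0r).
by apply: cvgMl; apply: cvgB; [apply: cvgB|]; exact: nsq_cvg.
Qed.

(** By uniqueness of limits, symmetry, linearity and the value on the diagonal all reduce to finite
    partial sums. *)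
Lemma l2_dot_unique x y (l : R[i]) :
  partial_dot x y A @[A --> totally] --> (l : R[i]^o) -> l2_dot x y = l.
Proof.
move=> h; rewrite -(cvg_lim (@norm_hausdorff _ _) h).
by rewrite (cvg_lim (@norm_hausdorff _ _) (@l2_dot_cvg x y)).
Qed.

Lemma partial_dot_conj (x y : J -> R[i]) A : partial_dot x y A = (partial_dot y x A)^*.
Proof.
rewrite /partial_dot rmorph_sum; apply: eq_bigr => j _.
by rewrite rmorphM /= conjcK mulrC.
Qed.

Lemma l2_dot_conj x y : l2_dot x y = (l2_dot y x)^*.
Proof.
have ReJ (z : R[i]) : complex.Re z^* = complex.Re z by case: z.
have ImJ (z : R[i]) : complex.Im z^* = - complex.Im z by case: z.
apply: l2_dot_unique; have /cvg_complexP[/= h1 h2] := @l2_dot_cvg y x.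
apply/cvg_complexP; split => /=.
  by under eq_cvg do rewrite partial_dot_conj ReJ.
by under eq_cvg do rewrite partial_dot_conj ImJ; exact: cvgN.
Qed.

Lemma l2_dot_linear y : GRing.linear_for *%R (l2_dot^~ y).
Proof.
move=> c x x' /=; apply: l2_dot_unique.
rewrite (_ : (fun A => _) = (fun A => c *: partial_dot x y A + partial_dot x' y A)).
  by apply: cvgD; [apply: cvgZr|]; exact: l2_dot_cvg.
apply/funext => A; rewrite /partial_dot scaler_sumr -big_split /=.
by apply: eq_bigr => j _; rewrite mulrDl -mulrA.
Qed.

Lemma l2_dotxx x : l2_dot x x = (nsq x)%:C.
Proof.
apply: l2_dot_unique; apply/cvg_complexP; split.
  rewrite (_ : (fun A => _) = partial_nsq x); first exact: nsq_cvg.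
  apply/funext => A; rewrite /partial_dot raddf_sum; apply: eq_bigr => j _.
  by rewrite -sqr_rnorm_conj.
rewrite (_ : (fun A => _) = cst 0); first exact: cvg_cst.
apply/funext => A; rewrite /partial_dot raddf_sum big1// => j _.
by rewrite -sqr_rnorm_conj.
Qed.

(** Conjugate linearity in the second argument follows from linearity in the first by Hermitian
    symmetry. *)
Lemma l2_dot_bilinear :
  bilinear_for (GRing.Scale.Law.clone _ _ *%R _)
    (GRing.Scale.Law.clone _ _ (Num.conj \; *%R) _) l2_dot.
Proof.
split=> [y|x]; first exact: l2_dot_linear.
move=> c y y' /=; rewrite l2_dot_conj l2_dot_linear rmorphD rmorphM.
by rewrite (l2_dot_conj x y) (l2_dot_conj x y').
Qed.

HB.instance Definition _ :=
  bilinear_isBilinear.Build R[i] l2 l2 R[i] _ _ l2_dot l2_dot_bilinear.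

Lemma l2_dot_herm x y : l2_dot x y = (-1) ^+ false * Num.conj (l2_dot y x).
Proof. by rewrite expr0 mul1r l2_dot_conj. Qed.

HB.instance Definition _ :=
  isHermitianSesquilinear.Build R[i] l2 false Num.conj l2_dot l2_dot_herm.

Lemma l2_dot_gt0 x : x != 0 -> 0 < l2_dot x x.
Proof.
move=> x0; rewrite l2_dotxx ltcR lt_def nsq_ge0 andbT.
by apply: contra_neq x0; exact: nsq_eq0.
Qed.

HB.instance Definition _ := isDotProduct.Build R[i] l2 l2_dot l2_dot_gt0.

Definition l2_dotp : {dot l2 for Num.conj} := l2_dot.

Definition l2_norm x : R[i] := (Num.sqrt (nsq x))%:C.

Lemma l2_normD x y : l2_norm (x + y) <= l2_norm x + l2_norm y.
Proof.
rewrite /l2_norm -rmorphD lecR -ler_sqr ?nnegrE ?addr_ge0 ?sqrtr_ge0//.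
rewrite sqrrD !sqr_sqrtr ?nsq_ge0// -lecR !rmorphD /= -!l2_dotxx.
have := dnormD l2_dotp x y; rewrite /= => ->.
rewrite [leRHS]addrAC lerD2l -rmorphD -mulr2n -mulr_natl /=.
rewrite addcJ -[2%:R](rmorph_nat (real_complex R)) -rmorphM lecR ler_pM2l ?ltr0n//.
(* After squaring, only the cross term is left: its real part is at most its modulus, which the
   Cauchy-Schwarz inequality bounds. *)
rewrite (le_trans (Re_le_rnorm _))// -sqrtrM ?nsq_ge0//.
rewrite -ler_sqr ?nnegrE ?rnorm_ge0 ?sqrtr_ge0// [leRHS]sqr_sqrtr ?mulr_ge0 ?nsq_ge0//.
rewrite -lecR rmorphXn rmorphM /= -rnormE -!l2_dotxx.
exact: (dot_CauchySchwarz l2_dotp).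
Qed.

Lemma nsqZ (c : R[i]) x : nsq (c *: x) = rnorm c ^+ 2 * nsq x.
Proof.
apply: complexI; rewrite rmorphM rmorphXn /= -rnormE -!l2_dotxx.
exact: (dnormZ l2_dotp).
Qed.

Lemma l2_normZ (c : R[i]) x : l2_norm (c *: x) = `|c| * l2_norm x.
Proof.
rewrite /l2_norm rnormE -rmorphM /=; congr (_%:C).
by rewrite nsqZ sqrtrM ?sqr_ge0// sqrtr_sqr ger0_norm ?rnorm_ge0.
Qed.

Lemma l2_norm_eq0 x : l2_norm x = 0 -> x = 0.
Proof.
move=> /(@complexI R _ 0)/eqP; rewrite sqrtr_eq0 => h.
by apply: nsq_eq0; apply/eqP; rewrite eq_le h nsq_ge0.
Qed.

HB.instance Definition _ :=
  Lmodule_isNormed.Build R[i] l2 l2_normD l2_normZ l2_norm_eq0.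

Lemma l2_normE x : `|x| = (Num.sqrt (nsq x))%:C.
Proof. by []. Qed.

Lemma l2_rnormE x : rnorm x ^+ 2 = nsq x.
Proof. by rewrite /rnorm l2_normE /= sqr_sqrtr ?nsq_ge0. Qed.

Lemma l2_norm_dot x : `|x| ^+ 2 = l2_dotp x x.
Proof. by rewrite l2_normE -rmorphXn /= sqr_sqrtr ?nsq_ge0// l2_dotxx. Qed.

(** Coordinates are dominated by the norm, hence converge along [F]. A bound on the partial sums of
    [x - f], uniform in the finite set, shows both that the coordinatewise limit [f] is square
    summable and that [F] converges to it. *)
Lemma l2_complete (F : set_system l2) : ProperFilter F -> cauchy F -> cvg F.
Proof.
move=> FF /cauchy_ballP Fc.
have {}Fc (e : R) : 0 < e ->
    \forall x \near F, \forall y \near F, rnorm (x - y) < e.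
  move=> e0; have := Fc e%:C; rewrite ltcR => /(_ e0) /=.
  move=> [[P Q] /= [FP FQ] PQ]; apply: filterS FP => x Px.
  apply: filterS FQ => y Qy; rewrite -ltcR -rnormE.
  by have := PQ (x, y) (conj Px Qy); rewrite /= -ball_normE.
have coord j : exists l : R[i], (fun x : l2 => x j) @ F --> (l : R[i]^o).
  apply: complex_cauchy_cvg => e e0.
  have [x xF] := filter_ex (Fc _ e0); exists (x j).
  apply: filterS xF => y; apply: le_lt_trans.
  rewrite -ler_sqr ?nnegrE ?rnorm_ge0// l2_rnormE -l2B.
  exact: nsq_ge.
have [f fl] := choice coord.
(* the partial sums of [x - f] are the limits of those of [x - y], [y] along [F] *)
have lim_le (e : R) : 0 < e -> \forall x \near F, forall A,
    partial_nsq (fun j => (x : l2) j - f j) A <= e ^+ 2.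
  move=> e0; apply: filterS (Fc _ e0) => x xF A.
  have : partial_nsq (fun j => x j - (y : l2) j) A @[y --> F] -->
      partial_nsq (fun j => x j - f j) A.
    rewrite /partial_nsq; apply: cvg_big => [|j _]; first exact: add_continuous.
    under eq_cvg do rewrite sqr_rnorm.
    rewrite sqr_rnorm; have /cvg_complexP[/= fr fi] := fl j.
    have hr : complex.Re (x j - (y : l2) j) @[y --> F] --> complex.Re (x j - f j).
      under eq_cvg do rewrite raddfB.
      by rewrite raddfB; apply: cvgB => //; exact: cvg_cst.
    have hi : complex.Im (x j - (y : l2) j) @[y --> F] --> complex.Im (x j - f j).
      under eq_cvg do rewrite raddfB.
      by rewrite raddfB; apply: cvgB => //; exact: cvg_cst.
    by apply: cvgD; rewrite !expr2; apply: cvgM.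
  move=> h; rewrite -(cvg_lim (@Rhausdorff R) h); apply: limr_le.
    by apply/cvg_ex; exists (partial_nsq (fun j => x j - f j) A).
  apply: filterS xF => y /ltW xy; rewrite (le_trans (partial_nsq_nsq (x - y) A))//.
  by rewrite -l2_rnormE ler_sqr ?nnegrE ?rnorm_ge0// ltW.
have fP : f \in square_summable.
  (* One [x] near [f] is enough: [f] is the difference of [x] and the square-summable family
     [x - f]. *)
  have [x hx] := filter_ex (lim_le _ ltr01).
  have -> : f = (x : J -> R[i]) - (fun j => x j - f j).
    by apply/funext => j /=; rewrite fctE opprB addrC subrK.
  rewrite rpredB ?l2P//; apply/mem_set; exists (1 ^+ 2); exact: hx.
apply/cvg_ex; exists (L2 fP); apply/cvgrPdist_lt => -[e e'].
rewrite ltcE /= => /andP[/eqP -> e0].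
(* Passing to the limit only gives a weak inequality; halving [e] makes it strict. *)
have e20 : 0 < e / 2 by rewrite divr_gt0.
apply: filterS (lim_le _ e20) => x hx.
rewrite distrC rnormE ltcR (@le_lt_trans _ _ (e / 2)) ?ltr_pdivrMr ?ltr_pMr ?ltr1n//.
rewrite -ler_sqr ?nnegrE ?rnorm_ge0 ?(ltW e20)// l2_rnormE.
by apply: nsq_le => A; exact: hx.
Qed.

HB.instance Definition _ := Uniform_isComplete.Build l2 l2_complete.

Definition l2_hilbert : hilbertSpace R := HilbertSpace l2_norm_dot.

End L2Space.

Arguments l2 : clear implicits.
Arguments l2_hilbert : clear implicits.



(** * Operator norms *)

Section UnitBallSup.
Context {R : realType} {E : lmodType R[i]} (f g : E -> R) (K : R).
Hypotheses (fZ : forall c v, f (c *: v) = rnorm c * f v)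
  (gZ : forall c v, g (c *: v) = rnorm c * g v) (g_ge0 : forall v, 0 <= g v)
  (fgK : forall v, f v <= K * g v).

(** Scale [v] into the unit ball. The bound by [K] makes the supremum finite and settles the case
    [g v = 0], where scaling is impossible. *)
Lemma unit_ball_sup_bound v : f v <= sup [set f w | w in [set w | g w <= 1]] * g v.
Proof.
have [gv0|gv0] := eqVneq (g v) 0.
  by rewrite gv0 mulr0 (le_trans (fgK v))// gv0 mulr0.
have gv : 0 < g v by rewrite lt_def gv0 g_ge0.
rewrite -ler_pdivrMr//; apply: ub_le_sup.
  (* No sign is assumed for [K], hence the absolute value. *)
  exists `|K| => _ [w /= w1 <-]; rewrite (le_trans (fgK w))//.
  rewrite (le_trans (ler_norm _))// normrM (ger0_norm (g_ge0 w)).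
  by rewrite -[leRHS]mulr1 ler_wpM2l.
exists ((g v)^-1%:C *: v) => /=.
  by rewrite gZ rnorm_real ?invr_ge0 ?(ltW gv)// mulVf.
by rewrite fZ rnorm_real ?invr_ge0 ?(ltW gv)// mulrC.
Qed.

Lemma unit_ball_sup_le M : 0 <= M -> (forall v, f v <= M * g v) ->
  sup [set f w | w in [set w | g w <= 1]] <= M.
Proof.
move=> M0 fM; apply: ge_sup => [|_ [w /= w1 <-]].
  by exists (f 0), 0 => //=; rewrite -(scale0r 0) gZ rnorm0 mul0r.
by rewrite (le_trans (fM w))// -[leRHS]mulr1 ler_wpM2l.
Qed.

Lemma unit_ball_sup_ge0 : 0 <= sup [set f w | w in [set w | g w <= 1]].
Proof.
have f0 : f 0 = 0 by rewrite -(scale0r 0) fZ rnorm0 mul0r.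
have g0 : g 0 = 0 by rewrite -(scale0r 0) gZ rnorm0 mul0r.
apply: ub_le_sup; last by exists 0; rewrite //= g0.
exists `|K| => _ [w /= w1 <-]; rewrite (le_trans (fgK w))//.
rewrite (le_trans (ler_norm _))// normrM (ger0_norm (g_ge0 w)).
by rewrite -[leRHS]mulr1 ler_wpM2l.
Qed.

End UnitBallSup.

Section L2Norm.
Context {R : realType}.

Section Normed.
Context {E : normedModType R[i]}.

Lemma l2norm_ge0 k (xi : 'I_k -> E) : 0 <= l2norm xi.
Proof. exact: sqrtr_ge0. Qed.

Lemma sqr_l2norm k (xi : 'I_k -> E) : l2norm xi ^+ 2 = \sum_i rnorm (xi i) ^+ 2.
Proof. by rewrite sqr_sqrtr// sumr_ge0// => i _; exact: sqr_ge0. Qed.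

Lemma rnorm_le_l2norm k (xi : 'I_k -> E) i : rnorm (xi i) <= l2norm xi.
Proof.
rewrite -ler_sqr ?nnegrE ?rnorm_ge0 ?l2norm_ge0// sqr_l2norm (bigD1 i)//=.
by rewrite lerDl sumr_ge0// => j _; exact: sqr_ge0.
Qed.

Lemma l2normZ k (c : R[i]) (xi : 'I_k -> E) :
  l2norm (fun i => c *: xi i) = rnorm c * l2norm xi.
Proof.
apply: (pexpIrn (n := 2)); rewrite ?nnegrE ?mulr_ge0 ?l2norm_ge0 ?rnorm_ge0//.
rewrite exprMn !sqr_l2norm mulr_sumr; apply: eq_bigr => i _.
by rewrite rnormZ exprMn.
Qed.

End Normed.

Lemma l2norm_leP (E F : normedModType R[i]) k l
    (xi : 'I_k -> E) (eta : 'I_l -> F) (M : R) :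
  0 <= M -> l2norm xi <= M * l2norm eta <->
  \sum_i rnorm (xi i) ^+ 2 <= M ^+ 2 * \sum_i rnorm (eta i) ^+ 2.
Proof.
move=> M0; rewrite -!sqr_l2norm -exprMn ler_sqr// nnegrE ?mulr_ge0 ?l2norm_ge0//.
Qed.

(* Crude, but it makes the suprema defining [opnorm] and [op_norms] finite. *)
Lemma l2norm_matrix_bound (E F : normedModType R[i]) k l (T : 'I_l -> 'I_k -> E -> F) 
    (M : 'I_l -> 'I_k -> R) (xi : 'I_k -> E) :
  (forall i j, 0 <= M i j) ->
  (forall i j x, rnorm (T i j x) <= M i j * rnorm x) ->
  l2norm (fun i => \sum_j T i j (xi j)) <=
  Num.sqrt (\sum_i (\sum_j M i j) ^+ 2) * l2norm xi.
Proof.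
move=> M0 TM; apply/l2norm_leP; first exact: sqrtr_ge0.
rewrite sqr_sqrtr; last by apply: sumr_ge0 => i _; exact: sqr_ge0.
rewrite -(sqr_l2norm xi) mulr_suml; apply: ler_sum => i _; rewrite -exprMn.
rewrite ler_sqr ?nnegrE ?rnorm_ge0 ?mulr_ge0 ?l2norm_ge0 ?sumr_ge0//.
rewrite (le_trans (rnorm_sum _ _ _))// mulr_suml ler_sum// => j _.
by rewrite (le_trans (TM _ _ _))// ler_wpM2l ?rnorm_le_l2norm.
Qed.

End L2Norm.

Section MatrixNorms.
Context {R : realType}.

Definition cvnsq n (v : 'cV[R[i]]_n) : R := \sum_a rnorm (v a 0) ^+ 2.

Lemma cvnsq_ge0 n (v : 'cV[R[i]]_n) : 0 <= cvnsq v.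
Proof. by apply: sumr_ge0 => a _; exact: sqr_ge0. Qed.

Lemma cvnsq0 n : cvnsq (0 : 'cV[R[i]]_n) = 0.
Proof. by rewrite /cvnsq big1// => a _; rewrite mxE rnorm0 expr0n. Qed.

Lemma cvnsqZ n (c : R[i]) (v : 'cV[R[i]]_n) : cvnsq (c *: v) = rnorm c ^+ 2 * cvnsq v.
Proof.
by rewrite /cvnsq mulr_sumr; apply: eq_bigr => a _; rewrite mxE rnormM exprMn.
Qed.

(** Collects what the lemmas on unit-ball suprema require in order to apply to [opnorm]. *)
Lemma opnorm_seminorms m n (A : 'M[R[i]]_(m, n)) :
  let f (v : 'cV[R[i]]_n) := l2norm (fun i => (A *m v) i 0) in
  let g (v : 'cV[R[i]]_n) := l2norm (fun i => v i 0) in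
  [/\ forall c v, f (c *: v) = rnorm c * f v,
      forall c v, g (c *: v) = rnorm c * g v,
      forall v, 0 <= g v & exists K, forall v, f v <= K * g v].
Proof.
split=> [c v|c v|v|]; last 1 first.
- exists (Num.sqrt (\sum_i (\sum_j rnorm (A i j)) ^+ 2)) => v.
  have := @l2norm_matrix_bound R R[i]^o R[i]^o n m (fun i j z => A i j * z)
    (fun i j => rnorm (A i j)) (fun j => v j 0).
  rewrite (_ : (fun i => \sum_j A i j * v j 0) = (fun i => (A *m v) i 0)).
    apply=> [i j|i j z]; [exact: rnorm_ge0|by rewrite rnormM].
  by apply/funext => i; rewrite mxE.
- rewrite -scalemxAr -(@l2normZ R R[i]^o) /=; congr l2norm.
  by apply/funext => i; rewrite mxE.
- rewrite -(@l2normZ R R[i]^o) /=; congr l2norm.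
  by apply/funext => i; rewrite mxE.
- exact: sqrtr_ge0.
Qed.

Lemma opnorm_ge0 m n (A : 'M[R[i]]_(m, n)) : 0 <= opnorm A.
Proof. by have [fZ gZ g0 [K fK]] := opnorm_seminorms A; exact: unit_ball_sup_ge0 fK. Qed.

Lemma opnorm_bound m n (A : 'M[R[i]]_(m, n)) (v : 'cV[R[i]]_n) :
  cvnsq (A *m v) <= opnorm A ^+ 2 * cvnsq v.
Proof.
have [fZ gZ g0 [K fK]] := opnorm_seminorms A.
apply/(@l2norm_leP R R[i]^o R[i]^o _ _ (fun i => (A *m v) i 0)).
  exact: opnorm_ge0.
exact: unit_ball_sup_bound fK v.
Qed.

Lemma opnorm_le m n (A : 'M[R[i]]_(m, n)) M : 0 <= M ->
  (forall v : 'cV[R[i]]_n, cvnsq (A *m v) <= M ^+ 2 * cvnsq v) -> opnorm A <= M.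
Proof.
have [fZ gZ g0 [K fK]] := opnorm_seminorms A.
move=> M0 AM; apply: unit_ball_sup_le => // v.
have [_] := @l2norm_leP R R[i]^o R[i]^o _ _ (fun i => (A *m v) i 0) (fun j => v j 0) _ M0.
by apply; exact: AM.
Qed.

(** The rows of a block column are in bijection, through [tagnat.rank], with the pairs of a block
    and a position in it. *)
Lemma cvnsq_mxcol k n (c : 'I_k -> 'cV[R[i]]_n) :
  cvnsq (\mxcol_j c j) = \sum_j cvnsq (c j).
Proof.
rewrite /cvnsq (reindex tagnat.rank) /=; last exact: tagnat.rank_bij_on.
rewrite sig_big_dep /=; apply: eq_bigr => -[i a] _ /=.
by rewrite -[in RHS](mxcolK c) [in RHS]mxE.
Qed.

Lemma mx_norms_ge0 n k (X : 'M['M[R[i]]_n.+1]_k.+1) : 0 <= mx_norms X.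
Proof. exact: opnorm_ge0. Qed.

(** Block multiplication turns the norm of the flattened matrix into an estimate on tuples of
    columns, so later arguments never see the flattening. *)
Lemma mx_norms_bound n k (X : 'M['M[R[i]]_n.+1]_k.+1) (c : 'I_k.+1 -> 'cV[R[i]]_n.+1) :
  \sum_i cvnsq (\sum_j X i j *m c j) <= mx_norms X ^+ 2 * \sum_j cvnsq (c j).
Proof.
have := opnorm_bound (\mxblock_(i < k.+1, j < k.+1) X i j) (\mxcol_j c j).
by rewrite mul_mxblock_mxrow !cvnsq_mxcol.
Qed.

Lemma mx_norms_le n k (X : 'M['M[R[i]]_n.+1]_k.+1) M : 0 <= M ->
  (forall c : 'I_k.+1 -> 'cV[R[i]]_n.+1,
    \sum_i cvnsq (\sum_j X i j *m c j) <= M ^+ 2 * \sum_j cvnsq (c j)) ->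
  mx_norms X <= M.
Proof.
move=> M0 XM; apply: opnorm_le => // v.
rewrite -(submxcolK v) mul_mxblock_mxrow !cvnsq_mxcol; exact: XM.
Qed.

(** * Matrix states as complete contractions *)

Section States.
Context {V : lmodType R[i]} (N : matrix_norms V) (HN : matricially_normed N) (u : V).

(** The completely bounded norm only controls unit balls; homogeneity of the norms extends the
    estimate to every [x]. *)
Lemma mx_states_le n (f : {linear V -> 'M[R[i]]_n.+1}) : mx_states N u f ->
  forall k (x : 'M[V]_k.+1), mx_norms (map_mx f x) <= @N k x.
Proof.
move=> [_ f1 _] k x.
have ball y : @N k y <= 1 -> mx_norms (map_mx f y) <= 1.
  move=> y1; rewrite -lee_fin; apply: le_trans f1.
  apply: (@le_trans _ _ (amp_norm N (@mx_norms R n) k f)).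
    by apply: ereal_sup_ubound; exists y.
  by apply: ereal_sup_ubound; exists k.
have [x0|x0] := eqVneq (@N k x) 0.
  rewrite x0 (mnorm0_eq0 HN x0) (_ : map_mx f 0 = 0); last first.
    by apply/matrixP => i j; rewrite !mxE raddf0.
  apply: mx_norms_le => // c; rewrite expr0n mul0r big1// => i _.
  rewrite big1 => [|j _]; last by rewrite mxE mul0mx.
  exact: cvnsq0.
have Nx : 0 < @N k x by rewrite lt_def x0 (mnorm_ge0 HN).
pose t := @N k x; have t0 : 0 <= t := ltW Nx.
apply: mx_norms_le => [|c]; first exact: ltW.
have := ball (map_mx ( *:%R (t^-1)%:C) x).
rewrite (mnormZ HN) rnorm_real ?invr_ge0 ?(ltW Nx)// mulVf// => /(_ (lexx _)) h.
(* Scaling the vectors by [t] undoes the normalization of [x] on the left-hand side and produces the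
   factor [t ^+ 2] on the right. *)
have := mx_norms_bound (map_mx f (map_mx ( *:%R (t^-1)%:C) x)) (fun j => t%:C *: c j).
have fE i : \sum_j (map_mx f (map_mx ( *:%R (t^-1)%:C) x)) i j *m (t%:C *: c j)
    = \sum_j (map_mx f x) i j *m c j.
  apply: eq_bigr => j _; rewrite !mxE (linearZ_LR f) -scalemxAl -scalemxAr scalerA.
  by rewrite -rmorphM mulVf// scale1r.
under eq_bigr do rewrite fE.
move=> /le_trans; apply; under eq_bigr do rewrite cvnsqZ rnorm_real//.
rewrite -mulr_sumr -[leRHS]mul1r ler_wpM2r ?mulr_ge0 ?sqr_ge0 ?sumr_ge0//.
  by move=> j _; exact: cvnsq_ge0.
by rewrite -(expr1n _ 2) ler_sqr ?nnegrE ?mx_norms_ge0.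
Qed.

Lemma mx_statesP n (f : {linear V -> 'M[R[i]]_n.+1}) :
  (forall k (x : 'M[V]_k.+1), mx_norms (map_mx f x) <= @N k x) -> f u = 1%:M ->
  mx_states N u f.
Proof.
move=> fN fu.
have f1 : (cb_norm N (@mx_norms R n) f <= 1)%E.
  apply: ge_ereal_sup => _ [k _ <-]; apply: ge_ereal_sup => _ [x /= x1 <-].
  by rewrite lee_fin (le_trans (fN k x)).
by split => //; rewrite /completely_bounded (le_lt_trans f1)// ltry.
Qed.

End States.
End MatrixNorms.

(** * Compression to a finite-dimensional subspace *)

Section OrthonormalFamilies.
Context {C : numClosedFieldType} {U : lmodType C} (dot : {dot U for Num.conj}).
Implicit Types (x v : U).

Definition orthonormal_family n (e : 'I_n -> U) : Prop :=
  forall a b, dot (e a) (e b) = (a == b)%:R.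

Definition orth_proj n (e : 'I_n -> U) x : U := \sum_a dot x (e a) *: e a.

Lemma dot_conj x y : dot x y = Num.conj (dot y x).
Proof. by have := hermC dot x y; rewrite expr0 mul1r. Qed.

Section Fixed.
Context {n : nat} (e : 'I_n -> U) (e_on : orthonormal_family e).

Lemma dot_suml (c : 'I_n -> C) x : dot (\sum_a c a *: e a) x = \sum_a c a * dot (e a) x.
Proof. by rewrite linear_sumlz; apply: eq_bigr => a _; rewrite linearZl_LR. Qed.

Lemma dot_sumr (c : 'I_n -> C) x :
  dot x (\sum_a c a *: e a) = \sum_a Num.conj (c a) * dot x (e a).
Proof. by rewrite linear_sumr; apply: eq_bigr => a _; rewrite linearZr_LR. Qed.

Lemma dot_sum_coord (c : 'I_n -> C) b : dot (\sum_a c a *: e a) (e b) = c b.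
Proof.
rewrite dot_suml (bigD1 b)//= e_on eqxx mulr1 big1 ?addr0// => a /negPf ab.
by rewrite e_on ab mulr0.
Qed.

Lemma dot_sum_sqr (c : 'I_n -> C) :
  dot (\sum_a c a *: e a) (\sum_a c a *: e a) = \sum_a `|c a| ^+ 2.
Proof.
rewrite dot_sumr; apply: eq_bigr => a _.
by rewrite dot_sum_coord normCK mulrC.
Qed.

Lemma dot_proj_orth x b : dot (x - orth_proj e x) (e b) = 0.
Proof. by rewrite linearBl /= dot_sum_coord subrr. Qed.

(** Pythagoras: [x] is the sum of its projection and an orthogonal remainder. *)
Lemma bessel x : \sum_a `|dot x (e a)| ^+ 2 <= dot x x.
Proof.
have h : dot (orth_proj e x) (x - orth_proj e x) = 0.
  rewrite dot_suml big1// => a _.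
  by rewrite (dot_conj (e a)) dot_proj_orth rmorph0 mulr0.
rewrite -[in leRHS](subrK (orth_proj e x) x) addrC hnormDd//= dot_sum_sqr.
by rewrite lerDl dnorm_ge0.
Qed.

End Fixed.

(** Lying in the span of [e] is expressed as being fixed by [orth_proj e]. In the induction, the
    remainder [w] of the new vector is normalized and adjoined, unless it vanishes. *)
Lemma gram_schmidt (s : seq U) : exists n (e : 'I_n -> U),
  orthonormal_family e /\ {in s, forall x, orth_proj e x = x}.
Proof.
elim: s => [|v s [n [e [e_on es]]]].
  by exists 0%N, (fun a => 0); split => [[]|].
pose w := v - orth_proj e v.
have [w0|w0] := eqVneq w 0.
  exists n, e; split => // x; rewrite inE => /predU1P[->|/es//].
  by apply/eqP; rewrite eq_sym -subr_eq0 -/w w0.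
have ew a : dot (e a) w = 0 by rewrite dot_conj dot_proj_orth// rmorph0.
have ww : 0 < dot w w by rewrite dnorm_gt0.
pose r := sqrtC (dot w w); have r0 : 0 < r by rewrite sqrtC_gt0.
(* The new vector takes index 0 and the old family is shifted by one. *)
pose e' a := oapp e (r^-1 *: w) (unlift ord0 a).
have e'0 : e' ord0 = r^-1 *: w by rewrite /e' unlift_none.
have e'S a : e' (lift ord0 a) = e a by rewrite /e' liftK.
have rR : Num.conj r^-1 = r^-1.
  by rewrite (CrealP _)// ger0_real// invr_ge0 ltW.
have dZ x : dot x (r^-1 *: w) = r^-1 * dot x w by rewrite linearZr_LR /= rR.
have projS x : orth_proj e' x = (r^-1 ^+ 2 * dot x w) *: w + orth_proj e x.
  rewrite /orth_proj big_ord_recl e'0 dZ scalerA mulrAC -expr2; congr (_ + _).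
  by apply: eq_bigr => a _; rewrite e'S.
exists n.+1, e'; split.
  move=> a b; case: (unliftP ord0 a) => [a' ->|->]; case: (unliftP ord0 b) => [b' ->|->].
  - by rewrite !e'S e_on (inj_eq (@lift_inj _ _)).
  - by rewrite e'S e'0 dZ ew mulr0.
  - by rewrite e'S e'0 dot_conj dZ ew mulr0 rmorph0.
  - rewrite e'0 dZ linearZl_LR /= mulrA -expr2 exprVn sqrtCK mulVf ?gt_eqF//.
(* An old vector is in the span of [e], hence orthogonal to [w], and its projection is unchanged. *)
move=> x; rewrite inE projS => /predU1P[->|xs]; last first.
  rewrite -[in dot _ _](es x xs) dot_suml big1 ?mulr0 ?scale0r ?add0r ?es// => a _.
  by rewrite ew mulr0.
(* Since [w] is orthogonal to the projection of [v], [dot v w] equals [dot w w], so the coefficient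
   of [w] is 1. *)
rewrite -[in dot _ _](subrK (orth_proj e v) v) -/w linearDl /= dot_suml.
have -> : \sum_a dot v (e a) * dot (e a) w = 0.
  by apply: big1 => a _; rewrite ew mulr0.
by rewrite addr0 exprVn sqrtCK mulVf ?gt_eqF// scale1r subrK.
Qed.

End OrthonormalFamilies.

(** * Norms of matrices of bounded operators *)

Section OperatorNorms.
Context {R : realType} {H : hilbertSpace R}.

Lemma boundedOp_linear (T : boundedOp H) : linear T.
Proof. by have /set_mem[] := boundedOpP T. Qed.

HB.instance Definition _ (T : boundedOp H) :=
  GRing.isLinear.Build R[i] H H *:%R T (boundedOp_linear T).

Lemma boundedOp_bound (T : boundedOp H) :
  exists2 M : R, 0 <= M & forall x, rnorm (T x) <= M * rnorm x.
Proof.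
have /set_mem[_ [M hM]] := boundedOpP T; exists `|M| => // x.
by rewrite (le_trans (hM x))// ler_wpM2r ?rnorm_ge0 ?ler_norm.
Qed.

Context {k : nat} (X : 'M[boundedOp H]_k.+1).

Let f (xi : 'I_k.+1 -> H) := l2norm (fun i => \sum_j X i j (xi j)).

Lemma op_norms_seminorms :
  [/\ forall c v, f (c *: v) = rnorm c * f v,
      forall c (v : 'I_k.+1 -> H), l2norm (c *: v) = rnorm c * l2norm v &
      exists K, forall v, f v <= K * l2norm v].
Proof.
split=> [c v|c v|].
- rewrite -l2normZ /f; congr l2norm; apply/funext => i.
  rewrite scaler_sumr; apply: eq_bigr => j _.
  by rewrite -linearZ_LR.
- by rewrite -l2normZ.
have /choice[M hM] (p : 'I_k.+1 * 'I_k.+1) : exists M, 0 <= M /\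
    forall x, rnorm (X p.1 p.2 x) <= M * rnorm x.
  by have [M M0 hM] := boundedOp_bound (X p.1 p.2); exists M.
exists (Num.sqrt (\sum_i (\sum_j M (i, j)) ^+ 2)) => v.
apply: (@l2norm_matrix_bound _ _ _ _ _ (fun i j x => X i j x) (fun i j => M (i, j))).
  by move=> i j; have [] := hM (i, j).
by move=> i j; have [] := hM (i, j).
Qed.

Lemma op_norms_ge0 : 0 <= op_norms X.
Proof.
have [fZ gZ [K fK]] := op_norms_seminorms.
by apply: (unit_ball_sup_ge0 fZ gZ _ fK) => v; exact: l2norm_ge0.
Qed.

Lemma op_norms_bound (xi : 'I_k.+1 -> H) :
  l2norm (fun i => \sum_j X i j (xi j)) <= op_norms X * l2norm xi.
Proof.
have [fZ gZ [K fK]] := op_norms_seminorms.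
by apply: (unit_ball_sup_bound fZ gZ _ fK) => v; exact: l2norm_ge0.
Qed.

Lemma op_norms_le M : 0 <= M ->
  (forall xi : 'I_k.+1 -> H, l2norm (fun i => \sum_j X i j (xi j)) <= M * l2norm xi) ->
  op_norms X <= M.
Proof. by have [_ gZ _] := op_norms_seminorms => M0 XM; exact: unit_ball_sup_le. Qed.

Lemma op_norms_adherent s : s < op_norms X -> exists2 xi : 'I_k.+1 -> H,
  l2norm xi <= 1 & s < l2norm (fun i => \sum_j X i j (xi j)).
Proof.
move=> /sup_gt[|_ [xi xi1 <-] lt]; last by exists xi.
have [_ gZ _] := op_norms_seminorms.
by exists (f 0), 0 => //=; rewrite -(scale0r 0) gZ rnorm0 mul0r.
Qed.

End OperatorNorms.

Lemma op_normsZ_le (R : realType) (H : hilbertSpace R) k (X : 'M[boundedOp H]_k.+1) c :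
  op_norms (map_mx ( *:%R c) X) <= rnorm c * op_norms X.
Proof.
apply: op_norms_le => [|xi]; first by rewrite mulr_ge0 ?rnorm_ge0 ?op_norms_ge0.
rewrite (_ : (fun i => _) = (fun i => c *: \sum_j X i j (xi j))).
  by rewrite l2normZ -mulrA ler_wpM2l ?rnorm_ge0 ?op_norms_bound.
by apply/funext => i; rewrite scaler_sumr; apply: eq_bigr => j _; rewrite mxE.
Qed.

(** * Compression of an operator-valued map to the span of an orthonormal family *)

Section Compression.
Context {R : realType} {H : hilbertSpace R} {V : lmodType R[i]}.
Variable Theta : {linear V -> boundedOp H}.
Context {n : nat} (e : 'I_n.+1 -> H).
Let dot := @hilbert_dot R H.
Hypothesis e_on : orthonormal_family dot e.

Lemma sqr_rnorm_dot (x : H) : (rnorm x ^+ 2)%:C = dot x x.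
Proof. by rewrite rmorphXn /= -rnormE hilbert_normE. Qed.

(** The matrix in the basis [e] of [Theta v] followed by projection to the span. The row index sits
    in the second slot because [dot] is linear in the first. *)
Definition compression (v : V) : 'M[R[i]]_n.+1 :=
  \matrix_(a, b) dot (Theta v (e b)) (e a).

Lemma compression_linear : linear compression.
Proof.
move=> c v w; apply/matrixP => a b; rewrite !mxE linearP.
by rewrite -[LHS]/(dot (c *: Theta v (e b) + Theta w (e b)) (e a)) linearDl linearZl_LR.
Qed.

HB.instance Definition _ :=
  GRing.isLinear.Build R[i] V 'M[R[i]]_n.+1 *:%R compression compression_linear.

Lemma compression1 u : Theta u = idOp H -> compression u = 1%:M.
Proof. by move=> Tu; apply/matrixP => a b; rewrite !mxE Tu e_on eq_sym. Qed.

(** Parseval's identity: synthesis along [e] embeds the columns isometrically in [H]. *)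
Lemma sqr_rnorm_sum_family (c : 'cV[R[i]]_n.+1) :
  rnorm (\sum_b c b 0 *: e b) ^+ 2 = cvnsq c.
Proof.
apply: complexI; rewrite sqr_rnorm_dot dot_sum_sqr// rmorph_sum; apply: eq_bigr => b _.
by rewrite rmorphXn /= rnormE.
Qed.

Lemma compression_mulmx k (x : 'M[V]_k.+1) (c : 'I_k.+1 -> 'cV[R[i]]_n.+1) i a :
  (\sum_j map_mx compression x i j *m c j) a 0 =
  dot (\sum_j (map_mx Theta x) i j (\sum_b c j b 0 *: e b)) (e a).
Proof.
rewrite summxE linear_sumlz; apply: eq_bigr => j _.
rewrite !mxE linear_sum linear_sumlz; apply: eq_bigr => b _.
by rewrite !mxE linearZ_LR linearZl_LR mulrC.
Qed.

(** The compressed action keeps only the coordinates along [e] of the vectors produced by [Theta],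
    and by Bessel's inequality this does not increase norms. *)
Lemma compression_le k (x : 'M[V]_k.+1) :
  mx_norms (map_mx compression x) <= op_norms (map_mx Theta x).
Proof.
apply: mx_norms_le => [|c]; first exact: op_norms_ge0.
pose xi j := \sum_b c j b 0 *: e b.
rewrite -(eq_bigr _ (fun j _ => sqr_rnorm_sum_family (c j))).
have /l2norm_leP := op_norms_bound (map_mx Theta x) xi.
move=> /(_ (op_norms_ge0 _)); apply: le_trans; apply: ler_sum => i _.
rewrite -lecR sqr_rnorm_dot rmorph_sum; apply: le_trans (bessel e_on _).
apply: ler_sum => a _; rewrite compression_mulmx /= rmorphXn /= -rnormE; exact: lexx.
Qed.

(** When the entries of [xi] and of its image lie in the span of [e], taking coordinates loses
    nothing, and Parseval replaces Bessel. *)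
Lemma compression_ge k (x : 'M[V]_k.+1) (xi : 'I_k.+1 -> H) :
  (forall j, orth_proj dot e (xi j) = xi j) ->
  (forall i, orth_proj dot e (\sum_j (map_mx Theta x) i j (xi j)) =
     \sum_j (map_mx Theta x) i j (xi j)) ->
  l2norm (fun i => \sum_j (map_mx Theta x) i j (xi j)) <=
  mx_norms (map_mx compression x) * l2norm xi.
Proof.
move=> xiE etaE; apply/l2norm_leP; first exact: mx_norms_ge0.
pose c j : 'cV[R[i]]_n.+1 := \col_b dot (xi j) (e b).
have cE j : \sum_b c j b 0 *: e b = xi j.
  by rewrite -[RHS]xiE; apply: eq_bigr => b _; rewrite mxE.
have := mx_norms_bound (map_mx compression x) c.
rewrite -(eq_bigr _ (fun j _ => sqr_rnorm_sum_family (c j))).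
under [X in _ <= _ * X -> _]eq_bigr do rewrite cE.
apply: le_trans; apply: ler_sum => i _.
rewrite -etaE -sqr_rnorm_sum_family le_eqVlt; apply/orP; left; apply/eqP.
congr (rnorm _ ^+ 2); apply: eq_bigr => a _; rewrite compression_mulmx.
by congr (dot _ _ *: _); apply: eq_bigr => j _; rewrite cE.
Qed.

End Compression.

(** * Square sums over a disjoint union of finite index sets *)

Section Fibers.
Context {R : realType} {S : choiceType} (d : S -> nat).
Let J := {s : S & 'I_(d s).+1}.
Implicit Types (x : J -> R[i]) (F : {fset S}) (A : {fset J}).

Definition fiber x s : 'cV[R[i]]_(d s).+1 := \col_a x (Tagged (fun s => 'I_(d s).+1) a).

Definition fibers F : {fset J} :=
  [fset Tagged (fun s => 'I_(d s).+1) a | s in F, a in {: 'I_(d s).+1}]%fset.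

Lemma partial_nsq_fibers x F : partial_nsq x (fibers F) = \sum_(s <- F) cvnsq (fiber x s).
Proof.
rewrite /partial_nsq /fibers big_imfset2 /=; last first.
  by move=> [s a] [t b] _ _ /=.
apply: eq_bigr => s _; rewrite /cvnsq big_enum /=.
by apply: eq_bigr => a _; rewrite mxE.
Qed.

(** Enlarge [A] to the union of all the fibers that it meets; estimates can then be made one whole
    fiber at a time. *)
Lemma partial_nsq_le_fibers x A :
  partial_nsq x A <= \sum_(s <- [fset tag j | j in A]%fset) cvnsq (fiber x s).
Proof.
rewrite -partial_nsq_fibers; apply: partial_nsq_le.
apply/fsubsetP => -[s a] jA; apply/imfset2P; exists s.
  by apply/imfsetP; exists (Tagged (fun s => 'I_(d s).+1) a).
by exists a.
Qed.

Lemma cvnsq_fiber_le (x : l2 R J) s : cvnsq (fiber x s) <= nsq x.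
Proof.
have := partial_nsq_nsq x (fibers [fset s]%fset).
by rewrite partial_nsq_fibers big_seq_fset1.
Qed.

Lemma fiberD x y s : fiber (x + y) s = fiber x s + fiber y s.
Proof. by apply/colP => a; rewrite !mxE. Qed.

Lemma fiberZ c x s : fiber (c *: x) s = c *: fiber x s.
Proof. by apply/colP => a; rewrite !mxE. Qed.

Lemma fiber_inj x y : (forall s, fiber x s = fiber y s) -> x = y.
Proof.
move=> xy; apply/funext => -[s a].
by have /colP/(_ a) := xy s; rewrite !mxE.
Qed.

(** The inclusion of one summand into the direct sum. *)
Definition extend s (c : 'cV[R[i]]_(d s).+1) : J -> R[i] :=
  untag 0 (fun a => c a 0).

Lemma fiber_extend s (c : 'cV[R[i]]_(d s).+1) : fiber (extend c) s = c.
Proof.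
apply/colP => a; rewrite mxE /extend.
by rewrite (untagE (T_ := fun s => 'I_(d s).+1) (u := Tagged _ a) _ _ erefl).
Qed.

Lemma fiber_extend_neq s (c : 'cV[R[i]]_(d s).+1) t : t != s -> fiber (extend c) t = 0.
Proof. by move=> ts; apply/colP => a; rewrite !mxE /extend untag_dflt. Qed.

Lemma partial_nsq_extend s (c : 'cV[R[i]]_(d s).+1) A :
  partial_nsq (extend c) A <= cvnsq c.
Proof.
rewrite (le_trans (partial_nsq_le_fibers _ _))//.
set F := [fset tag j | j in A]%fset.
have [sF|sF] := boolP (s \in F).
  rewrite (big_fsetD1 s)//= fiber_extend big_seq big1 ?addr0// => t.
  by rewrite !inE => /andP[ts _]; rewrite fiber_extend_neq// cvnsq0.
rewrite big_seq big1 ?cvnsq_ge0// => t tF.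
rewrite fiber_extend_neq; last by apply: contraNneq sF => <-.
by rewrite cvnsq0.
Qed.

Lemma extend_l2P s (c : 'cV[R[i]]_(d s).+1) : extend c \in @square_summable R J.
Proof. by apply/mem_set; exists (cvnsq c) => A; exact: partial_nsq_extend. Qed.

Definition extend_l2 s (c : 'cV[R[i]]_(d s).+1) : l2 R J := L2 (extend_l2P c).

Lemma nsq_extend s (c : 'cV[R[i]]_(d s).+1) : nsq (extend_l2 c) <= cvnsq c.
Proof. by apply: nsq_le => A; exact: partial_nsq_extend. Qed.

End Fibers.

(** * The direct sum of the matrix states *)

Section DirectSum.
Context {R : realType} {V : lmodType R[i]} (N : @matrix_norms R V).
Hypothesis HN : matricially_normed N.
Context {S : choiceType} (d : S -> nat) (f : forall s, {linear V -> 'M[R[i]]_((d s).+1)}).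
Hypothesis fN : forall s k (x : 'M[V]_k.+1), mx_norms (map_mx (f s) x) <= @N k x.
Let J := {s : S & 'I_(d s).+1}.
Let H := l2_hilbert R J.

(** The block-diagonal action, defined on arbitrary families so that square summability of the
    result can be proved afterwards. *)
Definition act v (x : J -> R[i]) : J -> R[i] :=
  fun j => (f (tag j) v *m fiber x (tag j)) (tagged j) 0.

Lemma fiber_act v x s : fiber (act v x) s = f s v *m fiber x s.
Proof. by apply/colP => a; rewrite mxE. Qed.

Lemma fiber_sum_act k (x : 'M[V]_k.+1) (xi : 'I_k.+1 -> J -> R[i]) i s :
  fiber (\sum_j act (x i j) (xi j)) s = \sum_j map_mx (f s) x i j *m fiber (xi j) s.
Proof.
have -> : fiber (\sum_j act (x i j) (xi j)) s = \sum_j fiber (act (x i j) (xi j)) s.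
  apply: (big_morph (fun y => fiber y s)) => [y z|]; first exact: fiberD.
  by apply/colP => a; rewrite !mxE.
by apply: eq_bigr => j _; rewrite fiber_act mxE.
Qed.

(** On each fiber the contractivity [fN] gives the estimate; sum it over the finitely many fibers
    that [A] meets. For 1 by 1 matrices this shows that [act v] preserves [l2], and in general it
    gives complete contractivity. *)
Lemma sum_partial_nsq_act k (x : 'M[V]_k.+1) (xi : 'I_k.+1 -> l2 R J) A :
  \sum_i partial_nsq (\sum_j act (x i j) (xi j)) A <= @N k x ^+ 2 * \sum_j nsq (xi j).
Proof.
set F := [fset tag j | j in A]%fset.
apply: (@le_trans _ _ (\sum_i \sum_(s <- F) cvnsq (fiber (\sum_j act (x i j) (xi j)) s))).
  by apply: ler_sum => i _; exact: partial_nsq_le_fibers.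
apply: (@le_trans _ _ (@N k x ^+ 2 * \sum_j partial_nsq (xi j) (fibers d F))); last first.
  by rewrite ler_wpM2l ?sqr_ge0// ler_sum// => j _; exact: partial_nsq_nsq.
under [in leRHS]eq_bigr do rewrite partial_nsq_fibers.
rewrite exchange_big [in leRHS]exchange_big mulr_sumr /=; apply: ler_sum => s _.
under eq_bigr do rewrite fiber_sum_act.
rewrite (le_trans (mx_norms_bound _ _))// ler_wpM2r ?sumr_ge0//.
  by move=> j _; exact: cvnsq_ge0.
by rewrite ler_sqr ?nnegrE ?mx_norms_ge0 ?(mnorm_ge0 HN) ?fN.
Qed.

Lemma partial_nsq_act v (x : l2 R J) A :
  partial_nsq (act v x) A <= @N 0 (const_mx v) ^+ 2 * nsq x.
Proof.
have := @sum_partial_nsq_act 0 (const_mx v) (fun=> x) A.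
by rewrite !big_ord1 mxE.
Qed.

Lemma act_l2P v (x : l2 R J) : act v x \in @square_summable R J.
Proof. by apply/mem_set; eexists => A; exact: partial_nsq_act. Qed.

Definition act_l2 v (x : H) : H := L2 (act_l2P v x).

Lemma act_l2_bounded v : act_l2 v \in @bounded_operator R H.
Proof.
apply/mem_set; split.
  move=> c x y; apply: val_inj; apply: fiber_inj => s.
  rewrite /= fiber_act fiberD fiberZ !(fiberD, fiberZ) !fiber_act.
  by rewrite mulmxDr scalemxAr.
exists (@N 0 (const_mx v)) => x.
rewrite -ler_sqr ?nnegrE ?mulr_ge0 ?rnorm_ge0 ?(mnorm_ge0 HN)// exprMn !l2_rnormE.
by apply: nsq_le => A; exact: partial_nsq_act.
Qed.

Definition direct_sum v : boundedOp H := BoundedOp (act_l2_bounded v).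

Lemma direct_sum_linear : linear direct_sum.
Proof.
move=> c v w; apply: val_inj; apply/funext => x.
apply: val_inj; apply: fiber_inj => s.
rewrite /= !(fiberD, fiberZ, fiber_act) linearP mulmxDl.
by rewrite scalemxAl.
Qed.

HB.instance Definition _ :=
  GRing.isLinear.Build R[i] V (boundedOp H) *:%R direct_sum direct_sum_linear.

Lemma direct_sum1 u : (forall s, f s u = 1%:M) -> direct_sum u = idOp H.
Proof.
move=> fu; apply: val_inj; apply/funext => x; apply: val_inj; apply: fiber_inj => s.
by rewrite fiber_act fu mul1mx.
Qed.

Lemma val_sum_act k (x : 'M[V]_k.+1) (xi : 'I_k.+1 -> H) i :
  l2_fun (\sum_j (map_mx direct_sum x) i j (xi j)) = \sum_j act (x i j) (xi j).
Proof.
rewrite (_ : l2_fun _ = \sum_j l2_fun ((map_mx direct_sum x) i j (xi j))).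
  by apply: eq_bigr => j _; rewrite mxE.
exact: (big_morph (@l2_fun R J)).
Qed.

Lemma direct_sum_le k (x : 'M[V]_k.+1) : op_norms (map_mx direct_sum x) <= @N k x.
Proof.
apply: op_norms_le => [|xi]; first exact: (mnorm_ge0 HN).
apply/l2norm_leP; first exact: (mnorm_ge0 HN).
under eq_bigr do rewrite l2_rnormE; under [in leRHS]eq_bigr do rewrite l2_rnormE.
set eta := fun i => \sum_j (map_mx direct_sum x) i j (xi j).
have etaE i : l2_fun (eta i) = \sum_j act (x i j) (xi j) by exact: val_sum_act.
(* The estimate holds for every finite set [A], the same for all rows, so it passes to the limit. *)
have h : \sum_i partial_nsq (eta i) A @[A --> totally] --> \sum_i nsq (eta i).
  by apply: cvg_big => [|i _]; [exact: add_continuous|exact: nsq_cvg].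
rewrite -(cvg_lim (@Rhausdorff R) h); apply: limr_le.
  by apply/cvg_ex; eexists; exact: h.
near=> A; apply: le_trans (sum_partial_nsq_act x xi A).
by apply: ler_sum => i _; rewrite etaE.
Unshelve. all: by end_near. Qed.

(** Test the direct sum on vectors supported in the fiber of [s], where it acts as [f s]. *)
Lemma direct_sum_ge s k (x : 'M[V]_k.+1) :
  mx_norms (map_mx (f s) x) <= op_norms (map_mx direct_sum x).
Proof.
apply: mx_norms_le => [|c]; first exact: op_norms_ge0.
pose xi j : H := extend_l2 (c j).
have /l2norm_leP := op_norms_bound (map_mx direct_sum x) xi.
move=> /(_ (op_norms_ge0 _)) h.
apply: (@le_trans _ _ (op_norms (map_mx direct_sum x) ^+ 2 * \sum_i rnorm (xi i) ^+ 2)).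
  apply: le_trans h; apply: ler_sum => i _; rewrite l2_rnormE.
  apply: le_trans (cvnsq_fiber_le _ s); rewrite val_sum_act fiber_sum_act.
  by under [in leRHS]eq_bigr do rewrite fiber_extend.
rewrite ler_wpM2l ?sqr_ge0// ler_sum// => j _.
by rewrite l2_rnormE nsq_extend.
Qed.

End DirectSum.

(** * The numerical index and the two implications *)

Section NumericalIndex.
Context {R : realType} {V : lmodType R[i]} (N : @matrix_norms R V).
Hypothesis HN : matricially_normed N.
Variable u : V.

Lemma state_seminorm_le k (x : 'M[V]_k.+1) : (state_seminorm N u x <= (@N k x)%:E)%E.
Proof.
apply: ge_ereal_sup => _ [n [f [fS ->]]].
by rewrite lee_fin (mx_states_le HN fS).
Qed.

Lemma n_cb_le k (x : 'M[V]_k.+1) : @N k x = 1 -> (n_cb N u <= state_seminorm N u x)%E.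
Proof. by move=> Nx; apply: ereal_inf_lbound; exists k, x. Qed.

(** The upper bound is witnessed by [u] itself as a 1 by 1 matrix of norm 1, because states are
    contractions. *)
Lemma n_cb_eq1 : @N 0 (const_mx u) = 1 ->
  (forall k (x : 'M[V]_k.+1), @N k x = 1 -> (1 <= state_seminorm N u x)%E) ->
  n_cb N u = 1%E.
Proof.
move=> Nu h; apply/eqP; rewrite eq_le; apply/andP; split.
  by rewrite (le_trans (n_cb_le Nu))// (le_trans (state_seminorm_le _))// Nu.
by apply: le_ereal_inf_tmp => _ [k [x [Nx ->]]]; exact: h.
Qed.

Lemma n_cb_of_isometry (H : hilbertSpace R) (Theta : {linear V -> boundedOp H}) :
  @N 0 (const_mx u) = 1 -> complete_isometry N (@op_norms R H) Theta ->
  Theta u = idOp H -> n_cb N u = 1%E.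
Proof.
move=> Nu iso Tu; apply: n_cb_eq1 => // k x Nx.
apply/lee_addgt0Pr => e e0.
(* A smaller [e] gives a stronger claim, and [e < 1] excludes an empty orthonormal family below. *)
wlog e1 : e e0 / e < 1.
  move=> wl; have m0 : 0 < Num.min e (1 / 2) by rewrite lt_min e0 divr_gt0.
  rewrite (le_trans (wl _ m0 _))//.
    by rewrite gt_min ltr_pdivrMr// mul1r ltr1n orbT.
  by rewrite leeD2l// lee_fin ge_min lexx.
have : 1 - e < op_norms (map_mx Theta x) by rewrite iso Nx ltrBlDr ltrDl.
move=> /op_norms_adherent[xi xi1 lt].
pose eta i := \sum_j (map_mx Theta x) i j (xi j).
have [n [E [E_on Es]]] := gram_schmidt (@hilbert_dot R H)
  ([seq xi j | j <- enum 'I_k.+1] ++ [seq eta i | i <- enum 'I_k.+1]).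
have xiE j : orth_proj (@hilbert_dot R H) E (xi j) = xi j.
  by apply: Es; rewrite mem_cat map_f ?mem_enum.
have etaE i : orth_proj (@hilbert_dot R H) E (eta i) = eta i.
  by apply: Es; rewrite mem_cat orbC map_f ?mem_enum.
(* States take values in matrices of positive size. An empty family would force [eta] to vanish,
   although its norm exceeds [1 - e]. *)
case: n E E_on Es xiE etaE => [|n] E E_on _ xiE etaE.
  have eta0 : l2norm eta = 0.
    rewrite /l2norm big1 ?sqrtr0// => i _.
    by rewrite -etaE /orth_proj big_ord0 rnorm0 expr0n.
  by move: lt; rewrite -/eta eta0 subr_lt0 ltNge (ltW e1).
have cS : mx_states N u (compression Theta E).
  apply: mx_statesP (compression1 E_on Tu) => l y.
  by rewrite -iso; exact: compression_le.
rewrite (@le_trans _ _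
  ((mx_norms (map_mx (compression Theta E) x))%:E + e%:E)%E)//; last first.
  by rewrite leeD2r//; apply: ereal_sup_ubound; exists n, (compression Theta E).
rewrite -EFinD lee_fin -lerBlDr (le_trans (ltW lt))//.
rewrite (le_trans (compression_ge E_on xiE etaE))//.
by rewrite -[leRHS]mulr1 ler_wpM2l ?mx_norms_ge0.
Qed.

(** States of all sizes are gathered in one type; [{classic _}] supplies the choice structure needed
    to form finite sets of indices. *)
Let index := {classic {s : {n : nat & {linear V -> 'M[R[i]]_n.+1}} |
  mx_states N u (projT2 s)}}.
Let dim (s : index) : nat := projT1 (sval s).
Let state (s : index) : {linear V -> 'M[R[i]]_((dim s).+1)} := projT2 (sval s).

Lemma isometry_of_n_cb : n_cb N u = 1%E ->
  exists (H : hilbertSpace R) (Theta : {linear V -> boundedOp H}),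
    complete_isometry N (@op_norms R H) Theta /\ Theta u = idOp H.
Proof.
move=> n1.
have sN (s : index) k (x : 'M[V]_k.+1) : mx_norms (map_mx (state s) x) <= @N k x.
  exact: (mx_states_le HN (svalP s)).
exists (l2_hilbert R _), (direct_sum HN sN); split; last first.
  by apply: direct_sum1 => s; have [_ _] := svalP s.
(* On the unit sphere the direct sum dominates every state, hence their supremum, which is at least
   [n_cb N u]. *)
have ge1 k (x : 'M[V]_k.+1) : @N k x = 1 -> 1 <= op_norms (map_mx (direct_sum HN sN) x).
  move=> Nx; rewrite -lee_fin -n1 (le_trans (n_cb_le Nx))//.
  apply: ge_ereal_sup => _ [n [f [fS ->]]]; rewrite lee_fin.
  exact: (direct_sum_ge HN sN (exist _ (existT _ n f) fS : index)).
move=> k x; apply/eqP; rewrite eq_le direct_sum_le /=.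
have [->|x0] := eqVneq (@N k x) 0; first exact: op_norms_ge0.
have Nx : 0 < @N k x by rewrite lt_def x0 (mnorm_ge0 HN).
(* Normalizing [x] carries the lower bound from the unit sphere to all matrices. *)
have := ge1 k (map_mx ( *:%R (@N k x)^-1%:C) x).
rewrite (mnormZ HN) rnorm_real ?invr_ge0 ?(ltW Nx)// mulVf// => /(_ erefl).
have -> : map_mx (direct_sum HN sN) (map_mx ( *:%R (@N k x)^-1%:C) x) =
    map_mx ( *:%R (@N k x)^-1%:C) (map_mx (direct_sum HN sN) x).
  by apply/matrixP => i j; rewrite !mxE linearZ_LR.
move=> /le_trans/(_ (op_normsZ_le _ _)).
by rewrite rnorm_real ?invr_ge0 ?(ltW Nx)// ler_pdivlMl ?mulr1.
Qed.

End NumericalIndex.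

Theorem theorem2p9 (R : realType) (V : lmodType R[i]) (N : matrix_norms V)
    (HN : matricially_normed N) (u : V)
    (hu : N 0%N (const_mx u) = 1) :
  complete_strict_geometric_unitary N u <->
  exists (H : hilbertSpace R) (Theta : {linear V -> boundedOp H}),
    complete_isometry N (@op_norms R H) Theta /\ Theta u = idOp H.
Proof.
split=> [|[H [T [iso Tu]]]]; first exact: isometry_of_n_cb.
exact: n_cb_of_isometry iso Tu.
Qed.
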